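(* There is no graph $G$ that is $P_4$-induced-saturated, and there is no graph $G$ that is $\{P_4, C_4\}$-induced-saturated.
   Context: All graphs are finite and simple. $P_4$ and $C_4$ denote the path and the cycle on $4$ vertices. For a family $\mathcal{F}$ of graphs, a graph $G$ is $\mathcal{F}$-induced-saturated if $G$ contains no induced subgraph isomorphic to a member of $\mathcal{F}$, but deleting any edge of $G$, or adding to $G$ any edge of its complement $\overline{G}$, results in a graph that contains an induced subgraph isomorphic to a member of $\mathcal{F}$. For $\mathcal{F}=\{H\}$ we say $H$-induced-saturated.
   Formalization: The graph G is required to have at least two vertices; a graph with at most one vertex has no edge to delete or add and contains no P_4 or C_4, so it is vacuously induced-saturated and the literal claim fails for it. *)

(* Defs.v *)
From mathcomp Require Import all_boot.

Set Implicit Arguments.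
Unset Strict Implicit.
Unset Printing Implicit Defensive.

Record sgraph := SGraph {
  vert :> finType;
  adj : rel vert;
  adj_sym : symmetric adj;
  adj_irr : irreflexive adj }.

Definition isomorphic (G H : sgraph) : Prop :=
  exists f : G -> H, bijective f /\ forall x y, adj (f x) (f y) = adj x y.

Section Operations.
Variable G : sgraph.

Definition induced_adj (S : {set G}) : rel {x : G | x \in S} :=
  [rel x y : {x : G | x \in S} | adj (val x) (val y)].

Lemma induced_sym S : symmetric (@induced_adj S).
Proof. by move=> x y; apply: adj_sym. Qed.

Lemma induced_irr S : irreflexive (@induced_adj S).
Proof. by move=> x; apply: adj_irr. Qed.

Definition induced (S : {set G}) : sgraph :=
  SGraph (@induced_sym S) (@induced_irr S).

Definition compl_adj : rel G := [rel x y | (x != y) && ~~ adj x y].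

Lemma compl_sym : symmetric compl_adj.
Proof. by move=> x y; rewrite /compl_adj /= eq_sym adj_sym. Qed.

Lemma compl_irr : irreflexive compl_adj.
Proof. by move=> x; rewrite /compl_adj /= eqxx. Qed.

Definition compl : sgraph := SGraph compl_sym compl_irr.

Variables u v : G.

Definition del_adj : rel G :=
  [rel x y | adj x y && ([set x; y] != [set u; v])].

Lemma del_sym : symmetric del_adj.
Proof. by move=> x y; rewrite /del_adj /= adj_sym setUC. Qed.

Lemma del_irr : irreflexive del_adj.
Proof. by move=> x; rewrite /del_adj /= adj_irr. Qed.

Definition del_edge : sgraph := SGraph del_sym del_irr.

(* The conjunct [x != y] only matters when u = v. *)
Definition add_adj : rel G :=
  [rel x y | (x != y) && (adj x y || ([set x; y] == [set u; v]))].

Lemma add_sym : symmetric add_adj.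
Proof. by move=> x y; rewrite /add_adj /= eq_sym adj_sym setUC. Qed.

Lemma add_irr : irreflexive add_adj.
Proof. by move=> x; rewrite /add_adj /= eqxx. Qed.

Definition add_edge : sgraph := SGraph add_sym add_irr.

End Operations.

Definition path_adj n : rel 'I_n :=
  [rel i j : 'I_n | (i.+1 == j :> nat) || (j.+1 == i :> nat)].

Lemma path_sym n : symmetric (@path_adj n).
Proof. by move=> i j; rewrite /path_adj /= orbC. Qed.

Lemma path_irr n : irreflexive (@path_adj n).
Proof. by move=> i; rewrite /path_adj /= orbb; apply/negbTE; rewrite neq_ltn ltnSn orbT. Qed.

Definition path_graph n : sgraph := SGraph (@path_sym n) (@path_irr n).

(* [ordS] is the cyclic successor, i |-> i + 1 mod n.  This is the n-cycle
   only for n >= 3. *)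
Definition cycle_adj n : rel 'I_n :=
  [rel i j : 'I_n | (i != j) && ((ordS i == j) || (ordS j == i))].

Lemma cycle_sym n : symmetric (@cycle_adj n).
Proof. by move=> i j; rewrite /cycle_adj /= eq_sym orbC. Qed.

Lemma cycle_irr n : irreflexive (@cycle_adj n).
Proof. by move=> i; rewrite /cycle_adj /= eqxx. Qed.

Definition cycle_graph n : sgraph := SGraph (@cycle_sym n) (@cycle_irr n).

Notation P4 := (path_graph 4).
Notation C4 := (cycle_graph 4).

Definition family := sgraph -> Prop.

Definition family1 (H : sgraph) : family := fun K => K = H.
Definition family2 (H1 H2 : sgraph) : family := fun K => K = H1 \/ K = H2.

Definition contains_induced (F : family) (G : sgraph) : Prop :=
  exists H, F H /\ exists S : {set G}, isomorphic (induced S) H.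

(* Vacuously, the graphs with at most one vertex (no edge to delete, none to
   add) that avoid F are F-induced-saturated in this literal sense. *)
Definition induced_saturated (F : family) (G : sgraph) : Prop :=
  [/\ ~ contains_induced F G,
      forall u v : G, adj u v -> contains_induced F (del_edge u v)
    & forall u v : G, @adj (compl G) u v -> contains_induced F (add_edge u v)].

(* Main.v *)
(** Toggling the adjacency of two twins u, v creates an induced copy of H only
    if H itself has a pair of twins, and P4 has none; so a P4-free graph that
    has twins is not P4-induced-saturated.  Twins exist: among the nonadjacent
    pairs take x, y with the most common neighbours.  Either x, y are twins, or
    some v is adjacent to exactly one of them, say x, and then x, v are twins.
    The only twins of C4 are its nonadjacent pairs, so a copy of C4 arises only
    when the edge between adjacent twins is deleted, and not even then if their
    neighbourhood is a clique; in a C4-free graph maximality ensures that. *)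
Require Import Defs.
From mathcomp Require Import all_boot.

Definition embeds (H G : sgraph) : Prop :=
  exists f : H -> G, injective f /\ forall x y : H, adj (f x) (f y) = adj x y.

(** The pair itself is exempt, so twins may be adjacent or not, and toggling that pair keeps them
    twins. *)
Definition twins (G : sgraph) (u v : G) : Prop :=
  forall w, w != u -> w != v -> adj u w = adj v w.

Lemma contains_inducedP (F : Defs.family) (G : sgraph) :
  contains_induced F G <-> exists H, F H /\ embeds H G.
Proof.
split=> [[H [FH [S [f [[g fK gK] fE]]]]]|[H [FH [f [fI fE]]]]]; exists H; split=> //.
  exists (fun x => val (g x)); split=> [x y xy|x y]; first exact: (can_inj gK) (val_inj xy).
  by rewrite -[x in RHS]gK -[y in RHS]gK fE.
have fS x : f x \in f @: [set: H] by rewrite imset_f.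
exists (f @: [set: H]).
pose h x : induced (f @: [set: H]) := exist _ (f x) (fS x).
have hI : injective h by move=> x y [] /fI.
have [|g hK gK] := inj_card_bij hI.
  by rewrite card_sig card_imset // cardsT.
exists g; split; first by exists h.
by move=> x y; rewrite -fE -[x in RHS]gK -[y in RHS]gK.
Qed.

(** * Recognising induced paths and cycles on four vertices *)

Lemma P4_embeds (G : sgraph) (a b c d : G) :
  adj a b -> adj b c -> adj c d ->
  ~~ adj a c -> ~~ adj a d -> ~~ adj b d -> embeds P4 G.
Proof.
move=> ab bc cd ac ad bd.
have Nac : a != c by apply: contraNneq ad => ->.
have Nad : a != d by apply: contraNneq bd => <-; rewrite adj_sym.
have Nbd : b != d by apply: contraNneq ad => <-.
have N (x y : G) : adj x y -> x != y by apply: contraTneq => ->; rewrite adj_irr.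
exists (fun i : 'I_4 => nth a [:: a; b; c; d] i); split=> [i j|].
  move/eqP; rewrite nth_uniq //= ?ltn_ord => [/eqP/val_inj //|].
  by rewrite !inE !negb_or Nac Nad Nbd !N.
move=> [[|[|[|[|//]]]] ?] [[|[|[|[|//]]]] ?] /=;
  rewrite /path_adj /= ?adj_irr ?ab ?bc ?cd ?(negbTE ac) ?(negbTE ad)
    ?(negbTE bd) // adj_sym ?ab ?bc ?cd //; exact: negbTE.
Qed.

(** Opposite vertices of a 4-cycle are twins, so adjacencies cannot tell them apart and their
    distinctness is assumed. *)
Lemma C4_embeds (G : sgraph) (a b c d : G) :
  adj a b -> adj b c -> adj c d -> adj d a ->
  a != c -> b != d -> ~~ adj a c -> ~~ adj b d -> embeds C4 G.
Proof.
move=> ab bc cd da Nac Nbd ac bd.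
have N (x y : G) : adj x y -> x != y by apply: contraTneq => ->; rewrite adj_irr.
exists (fun i : 'I_4 => nth a [:: a; b; c; d] i); split=> [i j|].
  move/eqP; rewrite nth_uniq //= ?ltn_ord => [/eqP/val_inj //|].
  by rewrite !inE !negb_or Nac Nbd (eq_sym a d) !N.
move=> [[|[|[|[|//]]]] ?] [[|[|[|[|//]]]] ?] /=;
  rewrite /cycle_adj /= -?val_eqE /= ?adj_irr ?ab ?bc ?cd ?da ?(negbTE ac)
    ?(negbTE bd) // adj_sym ?ab ?bc ?cd ?da //; exact: negbTE.
Qed.

Lemma P4_twins (i j : P4) : i != j -> ~ twins P4 i j.
Proof.
pose k n (n4 : n < 4) : P4 := Ordinal n4.
move=> ij tw.
(* Testing all four vertices before splitting turns every case into a computation. *)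
move: ij (tw (k 0 isT)) (tw (k 1 isT)) (tw (k 2 isT)) (tw (k 3 isT)) => {tw}.
by case: i j => [[|[|[|[|//]]]] ?] [[|[|[|[|//]]]] ?] //= _ h0 h1 h2 h3;
  solve [by have := h0 isT isT | by have := h1 isT isT
        | by have := h2 isT isT | by have := h3 isT isT].
Qed.

Lemma C4_twins (i j : C4) : i != j -> twins C4 i j ->
  ~~ adj i j /\ exists k l, [/\ k != l, adj i k, adj i l & ~~ adj k l].
Proof.
pose k n (n4 : n < 4) : C4 := Ordinal n4.
move=> ij tw.
move: ij (tw (k 0 isT)) (tw (k 1 isT)) (tw (k 2 isT)) (tw (k 3 isT)) => {tw}.
case: i j => [[|[|[|[|//]]]] ?] [[|[|[|[|//]]]] ?] //= _ h0 h1 h2 h3;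
  solve [by have := h0 isT isT | by have := h1 isT isT
        | by have := h2 isT isT | by have := h3 isT isT
        | by split=> //; exists (k 0 isT), (k 2 isT)
        | by split=> //; exists (k 1 isT), (k 3 isT)].
Qed.

(** Here [e] is the adjacency after the toggle. A copy of [H] that misses [u] or [v] contains no
    toggled pair, so it already lies in [G]. Otherwise the preimages of [u] and [v] are twins in
    [H], because pairs containing a third vertex are unchanged. *)
Lemma toggle_twins (G H : sgraph) (e : rel G) (u v : G) (f : H -> G) :
  (forall x y : G, e x y != adj x y -> [set x; y] = [set u; v]) ->
  twins G u v -> u != v -> injective f ->
  (forall x y : H, e (f x) (f y) = adj x y) ->
  embeds H G \/ exists i j, [/\ f i = u, f j = v, i != j & twins H i j].
Proof.
move=> eE tw uv fI fE.
have [/existsP[i /eqP fi]|Nu] := boolP [exists i, f i == u]; last first.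
  left; exists f; split=> // x y; rewrite -fE.
  apply/esym/eqP; apply: contraNT Nu => /eE /setP/(_ u); rewrite !inE eqxx /=.
  by case/orP=> /eqP->; apply/existsP; [exists x | exists y].
have [/existsP[j /eqP fj]|Nv] := boolP [exists i, f i == v]; last first.
  left; exists f; split=> // x y; rewrite -fE.
  apply/esym/eqP; apply: contraNT Nv => /eE /setP/(_ v); rewrite !inE eqxx orbT.
  by case/orP=> /eqP->; apply/existsP; [exists x | exists y].
right; exists i, j; split=> //; first by apply: contraNneq uv => ij; rewrite -fi ij fj.
move=> k ki kj; rewrite -!fE fi fj.
have ku : f k != u by rewrite -fi (inj_eq fI).
have kv : f k != v by rewrite -fj (inj_eq fI).
have eG w : e w (f k) = adj w (f k).
  apply/eqP; apply: contraNT ku => /eE/setP/(_ (f k)).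
  by rewrite !inE eqxx orbT (negbTE kv) orbF.
by rewrite !eG tw.
Qed.

(** * Nonadjacent pairs with the most common neighbours *)

Definition common_nbrs (G : sgraph) (a b : G) : {set G} := [set z | adj a z & adj b z].

Definition max_common_nbrs (G : sgraph) (x y : G) : Prop :=
  [/\ x != y, ~~ adj x y & forall a b : G, a != b -> ~~ adj a b ->
    #|common_nbrs G a b| <= #|common_nbrs G x y|].

Lemma max_common_nbrs_eq (G : sgraph) (x y a b : G) :
  max_common_nbrs G x y -> a != b -> ~~ adj a b ->
  common_nbrs G x y \subset common_nbrs G a b -> common_nbrs G x y = common_nbrs G a b.
Proof. by case=> _ _ max ab Nab sub; apply/eqP; rewrite eqEcard sub max. Qed.

Section Distinguisher.
Variables (G : sgraph) (x y : G).
Hypotheses (P4F : ~ embeds P4 G) (xy_max : max_common_nbrs G x y).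

(** Otherwise [v], [x], [z], [y] would be an induced path. *)
Lemma common_nbrs_distinguisher (v z : G) : adj x v -> ~~ adj y v ->
  z \in common_nbrs G x y -> adj v z.
Proof.
case: xy_max => xy Nxy _ xv yv; rewrite inE => /andP[xz yz].
apply/negPn/negP => vz; apply: P4F.
by apply: (P4_embeds G v x z y); rewrite // adj_sym.
Qed.

(** The vertex [x] would be one more common neighbour of [a] and [b], against maximality. *)
Lemma max_common_nbrs_nbr (a b : G) : a != b -> ~~ adj a b -> adj x a -> adj x b ->
  ~ common_nbrs G x y \subset common_nbrs G a b.
Proof.
move=> ab Nab xa xb sub; have /setP/(_ x) := max_common_nbrs_eq _ _ _ _ _ xy_max ab Nab sub.
by rewrite !inE adj_irr !(adj_sym _ x) xa xb.
Qed.

(** This lets [v] take the place of [x], which makes the later arguments symmetric in [x] and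
    [v]. *)
Lemma max_common_nbrs_distinguisher (v : G) : adj x v -> ~~ adj y v ->
  common_nbrs G v y = common_nbrs G x y /\ max_common_nbrs G v y.
Proof.
move=> xv yv; case: (xy_max) => xy Nxy max.
have vy : v != y by apply: contraNneq Nxy => <-.
have Nvy : ~~ adj v y by rewrite adj_sym.
have E : common_nbrs G x y = common_nbrs G v y.
  apply: max_common_nbrs_eq => //; apply/subsetP=> z zZ; rewrite inE.
  by rewrite (common_nbrs_distinguisher v) //; move: zZ; rewrite inE => /andP[].
by split=> //; split=> //; rewrite -E.
Qed.

Lemma distinguisher_nbr (v w : G) : adj x v -> ~~ adj y v -> w != v ->
  adj x w -> adj v w.
Proof.
move=> xv yv wv xw; have [E _] := max_common_nbrs_distinguisher v xv yv.
have [yw|yw] := boolP (adj y w).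
  by move/setP/(_ w): E; rewrite !inE xw yw !andbT.
(* Now [v] and [w] both see [x] but not [y], so each is adjacent to all common neighbours of [x] and
   [y]. *)
apply/negPn/negP => vw; apply: (max_common_nbrs_nbr v w) => //.
  by rewrite eq_sym.
by apply/subsetP=> z zZ; rewrite inE !(common_nbrs_distinguisher _ z).
Qed.

Lemma max_common_nbrs_clique : ~ embeds C4 G ->
  forall a b : G, adj x a -> adj x b -> a != b -> adj a b.
Proof.
move=> C4F a b xa xb ab; apply/negPn/negP => Nab.
case: (xy_max) => xy Nxy _.
(* If [y] sees both [a] and [b], they close an induced 4-cycle; if it sees one, the other is a
   distinguisher; if neither, both are. *)
have [ya|ya] := boolP (adj y a); have [yb|yb] := boolP (adj y b).
- by apply: C4F; apply: (C4_embeds G x a y b); rewrite // adj_sym.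
- case/negP: Nab; rewrite adj_sym.
  by apply: common_nbrs_distinguisher; rewrite // inE xa.
- by case/negP: Nab; apply: common_nbrs_distinguisher; rewrite // inE xb.
- apply: (max_common_nbrs_nbr a b) => //.
  by apply/subsetP=> z zZ; rewrite inE !(common_nbrs_distinguisher _ z).
Qed.

End Distinguisher.

Lemma distinguisher_twins (G : sgraph) (x y v : G) :
  ~ embeds P4 G -> max_common_nbrs G x y -> adj x v -> ~~ adj y v -> twins G x v.
Proof.
move=> P4F max xv yv w wx wv; have [_ Nxy _] := max.
have [_ maxv] := max_common_nbrs_distinguisher _ _ _ P4F max v xv yv.
apply/idP/idP; first exact: (distinguisher_nbr _ _ _ P4F max).
(* The reverse inclusion uses the maximal pair [v], [y], with [x] as its distinguisher. *)
by apply: (distinguisher_nbr _ _ _ P4F maxv); rewrite // adj_sym.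
Qed.

Lemma exists_max_common_nbrs (G : sgraph) (a b : G) :
  a != b -> ~~ adj a b -> exists x y, max_common_nbrs G x y.
Proof.
move=> ab Nab.
pose P (p : G * G) := (p.1 != p.2) && ~~ adj p.1 p.2.
have Pab : P (a, b) by rewrite /P ab.
case: (arg_maxnP (fun p => #|common_nbrs G p.1 p.2|) Pab) => -[x y] /andP[xy Nxy] max.
exists x, y; split=> // c d cd Ncd; apply: (max (c, d)).
by rewrite /P cd.
Qed.

(** In a complete graph any two vertices serve. The clique condition is required only of adjacent
    twins, so it is vacuous when [x] and [y] themselves are twins. *)
Lemma exists_twins (G : sgraph) : ~ embeds P4 G -> 1 < #|G| ->
  exists u v, [/\ u != v, twins G u v & adj u v -> ~ embeds C4 G ->
    forall a b : G, adj u a -> adj u b -> a != b -> adj a b].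
Proof.
move=> P4F /card_gt1P[u [v [_ _ uv]]].
have [/existsP[a /existsP[b /andP[ab Nab]]]|] :=
  boolP [exists a : G, exists b : G, (a != b) && ~~ adj a b]; last first.
  rewrite negb_exists => /forallP K.
  have {}K (a b : G) : a != b -> adj a b.
    by move=> ab; move: (K a); rewrite negb_exists => /forallP/(_ b); rewrite ab negbK.
  exists u, v; split=> // [w wu wv|_ _ a b _ _]; last exact: K.
  by rewrite !K // eq_sym.
have [x [y max]] := exists_max_common_nbrs _ _ _ ab Nab.
have [xy Nxy maxE] := max.
have max' : max_common_nbrs G y x.
  split=> [||c d cd Ncd]; rewrite 1?eq_sym 1?adj_sym //.
  have -> : common_nbrs G y x = common_nbrs G x y by apply/setP=> z; rewrite !inE andbC.
  exact: maxE.
have [/existsP[v' ]|] := boolP [exists z, adj x z != adj y z]; last first.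
  rewrite negb_exists => /forallP E; exists x, y; split=> //.
    by move=> w _ _; apply/eqP; rewrite -[_ == _]negbK.
  by rewrite (negbTE Nxy).
have N (c d : G) : adj c d -> c != d by apply: contraTneq => ->; rewrite adj_irr.
have [xv|xv] := boolP (adj x v'); have [yv|yv] := boolP (adj y v') => // _.
  exists x, v'; split=> [||_]; first exact: N.
    exact: (distinguisher_twins _ _ y).
  exact: (max_common_nbrs_clique _ _ y).
exists y, v'; split=> [||_]; first exact: N.
  exact: (distinguisher_twins _ _ x).
exact: (max_common_nbrs_clique _ _ x).
Qed.

Lemma not_induced_saturated (F : Defs.family) (G : sgraph) :
  F P4 -> (forall H, F H -> H = P4 \/ H = C4) -> 1 < #|G| -> ~ induced_saturated F G.
Proof.
move=> FP4 FE G1 [/contains_inducedP FG del add].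
have FF H : F H -> ~ embeds H G by move=> FH HG; apply: FG; exists H.
have [u [v [uv tw clique]]] := exists_twins G (FF _ FP4) G1.
have [auv|Nuv] := boolP (adj u v).
  have /contains_inducedP[H [FH [f [fI fE]]]] := del u v auv.
  have eE (x y : G) : del_adj u v x y != adj x y -> [set x; y] = [set u; v].
    by rewrite /del_adj /=; case: (_ =P [set u; v]) => //; rewrite andbT eqxx.
  case: (toggle_twins G H (del_adj u v) u v f eE tw uv fI fE) => [/FF //|].
  case=> i [j [fi fj ij twH]].
  case: (FE _ FH) => E; subst H; first exact: P4_twins twH.
  have [Nij [k [l [kl ik il /negP[]]]]] := C4_twins i j ij twH.
  have kN (m : C4) : adj i m -> (f m != u) && (f m != v).
    rewrite -fi -fj !(inj_eq fI) => im.
    by apply/andP; split; apply: contraTneq im => ->; rewrite ?adj_irr.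
  have up (m : C4) : adj i m -> adj u (f m) by rewrite -fE fi => /andP[].
  (* The images of [k] and [l] are adjacent in [G] by the clique condition, and their edge is not
     the deleted one; yet [k] and [l] are nonadjacent in the cycle. *)
  rewrite -fE; apply/andP; split.
    by apply: clique; rewrite ?(inj_eq fI) // ?up //; apply: FF.
  apply/eqP=> /setP/(_ (f k)); rewrite !inE eqxx /=.
  by case/andP: (kN k ik) => /negbTE-> /negbTE->.
have /contains_inducedP[H [FH [f [fI fE]]]] : contains_induced F (add_edge u v).
  by apply: add; apply/andP.
have eE (x y : G) : add_adj u v x y != adj x y -> [set x; y] = [set u; v].
  rewrite /add_adj /=; case: (_ =P [set u; v]) => //; rewrite orbF.
  by have [->|] := eqVneq x y; rewrite ?adj_irr //= eqxx.
case: (toggle_twins G H (add_adj u v) u v f eE tw uv fI fE) => [/FF //|].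
case=> i [j [fi fj ij twH]].
case: (FE _ FH) => E; subst H; first exact: P4_twins twH.
(* Twins of the 4-cycle are nonadjacent, but the added edge joins [i] and [j]. *)
have [/negP Nij _] := C4_twins i j ij twH; apply: Nij.
by rewrite -fE fi fj; apply/andP; rewrite eqxx orbT.
Qed.

(** The bound on [#|G|] excludes the vacuously saturated graphs. *)
Theorem theorem19 :
  (~ exists G : sgraph, 1 < #|G| /\ induced_saturated (family1 P4) G) /\
  (~ exists G : sgraph, 1 < #|G| /\ induced_saturated (family2 P4 C4) G).
Proof.
split=> -[G [G1]]; apply: not_induced_saturated => //.
- by move=> H ->; left.
- by left.
Qed.
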